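(* In the setting described in the context, let $(\theta_*,0,u_* )$ be an angle-cohesive operating point with line flow $f_*=f(\theta_*,u_* )$ satisfying $p=Bf_*$ and $P_H^{W_*}f_*=0$. Let $\kappa,\tau>0$. Consider the ideal tangent system for $(\vartheta,\nu,w)\in\mathbb{R}^n\times\mathbb{R}^n\times X$, $$\dot\vartheta=\nu,\qquad M\dot\nu=-D\nu-Br,\qquad \tau\dot w=-\kappa W_*^{-1}P_H^{W_*}r,\qquad r=W_*B^\top\vartheta+W_*w .$$ Every solution satisfies $$\tau\frac{d}{dt}P_H^{W_*}r=-\kappa P_H^{W_*}r,$$ and consequently $$P_H^{W_*}r(t)=e^{-(\kappa/\tau)t}P_H^{W_*}r(0)\qquad(t\ge0).$$ Moreover, with $r_C=P_C^{W_*}r$ and $h=H_*^\top W_*^{-1}r$, the effective output state $(\nu,r_C,h)\in\mathbb{R}^n\times\mathcal{C}_*\times\mathbb{R}^{b_1}$ satisfies the block-separated system $$M\dot\nu=-D\nu-Br_C,\qquad \dot r_C=W_*B^\top\nu,\qquad \tau\dot h=-\kappa h .$$ Let $\mathcal{A}_{\rm sw}$ denote the generator of the first two of these equations on $\mathbb{R}^n\times\mathcal{C}_*$ and let $\mathcal{A}_{\rm id}^{\rm eff}$ denote the generator of all three equations on $\mathbb{R}^n\times\mathcal{C}_*\times\mathbb{R}^{b_1}$. Then $$\mathcal{A}_{\rm id}^{\rm eff}=\mathcal{A}_{\rm sw}\oplus\left(-\frac{\kappa}{\tau}I_{b_1}\right),$$ and hence the characteristic polynomials satisfy $$\chi_{\mathcal{A}_{\rm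 id}^{\rm eff}}(\lambda)=\chi_{\mathcal{A}_{\rm sw}}(\lambda)\left(\lambda+\frac{\kappa}{\tau}\right)^{b_1}.$$ Thus the ideal generator preserves the passive swing spectrum (that of $\mathcal{A}_{\rm sw}$) and appends the eigenvalue $-\kappa/\tau$ with algebraic multiplicity $b_1$. In particular, $\mathcal{A}_{\rm id}^{\rm eff}$ is Hurwitz if and only if $\mathcal{A}_{\rm sw}$ is Hurwitz. Under the standing assumptions that the graph is connected and $M,D,W_*>0$, both generators are Hurwitz.
   Context: $G=(V,E)$ is a finite connected graph with $n=|V|$, $m=|E|$, a fixed orientation of each edge, edge space $X=\mathbb{R}^E\cong\mathbb{R}^m$, and incidence matrix $B:X\to\mathbb{R}^n$ whose column for each oriented edge has entry $+1$ at the tail and $-1$ at the head; $b_1=m-n+1=\dim\ker B$. $M,D\in\mathbb{R}^{n\times n}$ are positive diagonal. With line coefficients $a_e>0$, the line-flow map is $f(\theta,u)=\operatorname{diag}(a)\sin(B^\top\theta+u)\in X$ for $\theta\in\mathbb{R}^n$, $u\in X$ (sine componentwise). $p\in\mathbb{R}^n$ is the injection vector. Operating point: $\theta_*\in\mathbb{R}^n$, $u_*\in X$, $\eta_*=B^\top\theta_*+u_*$, $f_*=f(\theta_*,u_* )$. It is angle-cohesive if for some $0<\gamma<\pi/2$ one has $|\operatorname{pr}(\eta_{*,e})|\le\gamma$ for all $e\in E$, where $\operatorname{pr}(x)\in[-\pi,\pi)$ is the representative of $x$ modulo $2\pi$. Then $W_*=\operatorname{diag}\bigl(a_e\cos(\operatorname{pr}(\eta_{*,e}))\bigr)$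 is positive diagonal. Weighted projections: $H_*:\mathbb{R}^{b_1}\to X$ is a linear map whose columns form a basis of $\ker B$ with $H_*^\top W_*^{-1}H_*=I_{b_1}$; $P_H^{W_*}=H_*H_*^\top W_*^{-1}$ is the projection onto $\ker B$ orthogonal for the inner product $x^\top W_*^{-1}y$, and $P_C^{W_*}=I-P_H^{W_*}$ is the projection onto the weighted cut space $\mathcal{C}_*=\operatorname{im}(W_*B^\top)=(\ker B)^{\perp_{W_*^{-1}}}$. Thus $r=r_C+H_*h$. The tangent system in the claim is the linearization at $(\theta_*,0,u_* )$ of the closed loop $\dot\theta=\omega$, $M\dot\omega=p-D\omega-Bf(\theta,u)$, $\tau\dot u=-\kappa W_*^{-1}P_H^{W_*}(f(\theta,u)-f_* )$, with deviations $\vartheta=\theta-\theta_*$, $\nu=\omega$, $w=u-u_*$. The generator of a linear ODE $\dot z=\mathcal{A}z$ is $\mathcal{A}$; it is Hurwitz if all its eigenvalues have negative real part. *)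

(* Defs.v *)
From HB Require Import structures.
From mathcomp Require Import all_boot all_order all_algebra.
From mathcomp Require Import all_classical all_reals all_analysis.
From mathcomp Require Import complex lra.

Set Implicit Arguments.
Unset Strict Implicit.
Unset Printing Implicit Defensive.

Import Order.TTheory GRing.Theory Num.Theory.
Import numFieldNormedType.Exports.

Local Open Scope ring_scope.

(** * Oriented graphs

    The vertices are ['I_n], the edges are ['I_m], and edge [e] is oriented
    from [tail e] to [head e]; vectors are column vectors. *)

Definition loopless (n m : nat) (tail head : 'I_m -> 'I_n) : Prop :=
  forall e, tail e != head e.

Definition graph_adj (n m : nat) (tail head : 'I_m -> 'I_n) : rel 'I_n :=
  fun x y => [exists e, ((tail e == x) && (head e == y))
                     || ((tail e == y) && (head e == x))].

Definition graph_connected (n m : nat) (tail head : 'I_m -> 'I_n) : Prop :=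
  (0 < n)%N /\ forall x y, connect (graph_adj tail head) x y.

Definition incidence_mx (R : realType) (n m : nat) (tail head : 'I_m -> 'I_n) :
    'M[R]_(n, m) :=
  \matrix_(i, e) ((i == tail e)%:R - (i == head e)%:R).

(** Written [m.+1 - n] rather than [m - n + 1] because subtraction on [nat] is
    truncated and a tree has [m = n - 1]; a connected graph has [n <= m.+1]. *)
Definition betti1 (n m : nat) : nat := (m.+1 - n)%N.

Definition pos_diag_mx (R : realType) (n : nat) (A : 'M[R]_n) : Prop :=
  is_diag_mx A /\ forall i, 0 < A i i.

(** * Line flow and operating point *)

Definition edge_angle (R : realType) (n m : nat) (B : 'M[R]_(n, m))
    (theta : 'cV[R]_n) (u : 'cV[R]_m) : 'cV[R]_m :=
  B^T *m theta + u.

Definition line_flow (R : realType) (n m : nat) (a : 'rV[R]_m)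
    (B : 'M[R]_(n, m)) (theta : 'cV[R]_n) (u : 'cV[R]_m) : 'cV[R]_m :=
  diag_mx a *m map_mx sin (edge_angle B theta u).

(** The representative of [x] modulo [2 * pi] in [[- pi, pi[]. *)
Definition principal (R : realType) (x : R) : R :=
  x - (2 * pi) * (Num.floor ((x + pi) / (2 * pi)))%:~R.

Definition angle_cohesive (R : realType) (n m : nat) (B : 'M[R]_(n, m))
    (theta : 'cV[R]_n) (u : 'cV[R]_m) : Prop :=
  exists gamma : R, 0 < gamma < pi / 2 /\
    forall e, `|principal (edge_angle B theta u e 0)| <= gamma.

Definition flow_weight (R : realType) (n m : nat) (a : 'rV[R]_m)
    (B : 'M[R]_(n, m)) (theta : 'cV[R]_n) (u : 'cV[R]_m) : 'M[R]_m :=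
  diag_mx (\row_e (a 0 e * cos (principal (edge_angle B theta u e 0)))).

(** * Weighted cycle/cut decomposition *)

(** [kermx] and the row-space operations act on row vectors, hence the
    transposes: the columns of [H] form a basis of the kernel of [B]. *)
Definition cycle_basis (R : realType) (n m k : nat) (B : 'M[R]_(n, m))
    (H : 'M[R]_(m, k)) : Prop :=
  row_free H^T /\ (H^T == kermx B^T)%MS.

Definition cycle_proj (R : realType) (m k : nat) (W : 'M[R]_m)
    (H : 'M[R]_(m, k)) : 'M[R]_m :=
  H *m H^T *m invmx W.

Definition cut_proj (R : realType) (m k : nat) (W : 'M[R]_m)
    (H : 'M[R]_(m, k)) : 'M[R]_m :=
  1%:M - cycle_proj W H.

Definition cut_space (R : realType) (n m : nat) (B : 'M[R]_(n, m))
    (W : 'M[R]_m) : {vspace 'cV[R]_m} :=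
  limg (linfun (mulmx (W *m B^T)) : 'Hom('cV[R]_n, 'cV[R]_m)).

(** * Solutions of the two systems on [[0, +oo[]

    Solutions are continuous on [[0, +oo[] and satisfy the equations at every
    positive time. *)

Definition tangent_output (R : realType) (n m : nat) (B : 'M[R]_(n, m))
    (W : 'M[R]_m) (vth : R -> 'cV[R]_n) (w : R -> 'cV[R]_m) : R -> 'cV[R]_m :=
  fun t => W *m B^T *m vth t + W *m w t.

Definition tangent_solution (R : realType) (n m k : nat) (M D : 'M[R]_n)
    (B : 'M[R]_(n, m)) (W : 'M[R]_m) (H : 'M[R]_(m, k)) (kappa tau : R)
    (vth nu : R -> 'cV[R]_n) (w : R -> 'cV[R]_m) : Prop :=
  let r := tangent_output B W vth w in
  [/\ derivable_oy_Rcontinuous vth 0,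
      derivable_oy_Rcontinuous nu 0,
      derivable_oy_Rcontinuous w 0
    & forall t, 0 < t ->
      [/\ derive1 vth t = nu t,
          M *m derive1 nu t = - (D *m nu t) - B *m r t
        & tau *: derive1 w t
            = - kappa *: (invmx W *m (cycle_proj W H *m r t))]].

Definition block_solution (R : realType) (n m k : nat) (M D : 'M[R]_n)
    (B : 'M[R]_(n, m)) (W : 'M[R]_m) (kappa tau : R)
    (nu : R -> 'cV[R]_n) (rC : R -> 'cV[R]_m) (h : R -> 'cV[R]_k) : Prop :=
  [/\ derivable_oy_Rcontinuous nu 0,
      derivable_oy_Rcontinuous rC 0,
      derivable_oy_Rcontinuous h 0,
      forall t, 0 <= t -> rC t \in cut_space B W
    & forall t, 0 < t ->
      [/\ M *m derive1 nu t = - (D *m nu t) - B *m rC t,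
          derive1 rC t = W *m B^T *m nu t
        & tau *: derive1 h t = - kappa *: h t]].

(** * Generators *)

Definition sw_space (R : realType) (n m : nat) (B : 'M[R]_(n, m))
    (W : 'M[R]_m) : vectType R :=
  ('cV[R]_n * subvs_of (cut_space B W))%type.

Definition eff_space (R : realType) (n m k : nat) (B : 'M[R]_(n, m))
    (W : 'M[R]_m) : vectType R :=
  (sw_space B W * 'cV[R]_k)%type.

(** [W *m B^T *m nu] lies in the cut space, so that [vsproj] merely retypes
    it (lemma [sw_generatorE]). *)
Definition sw_field (R : realType) (n m : nat) (M D : 'M[R]_n)
    (B : 'M[R]_(n, m)) (W : 'M[R]_m) (z : sw_space B W) : sw_space B W :=
  (invmx M *m (- (D *m z.1) - B *m vsval z.2),
   vsproj (cut_space B W) (W *m B^T *m z.1)).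

Definition eff_field (R : realType) (n m k : nat) (M D : 'M[R]_n)
    (B : 'M[R]_(n, m)) (W : 'M[R]_m) (kappa tau : R)
    (z : eff_space k B W) : eff_space k B W :=
  ((invmx M *m (- (D *m z.1.1) - B *m vsval z.1.2),
    vsproj (cut_space B W) (W *m B^T *m z.1.1)),
   tau^-1 *: (- kappa *: z.2)).

Definition sw_generator (R : realType) (n m : nat) (M D : 'M[R]_n)
    (B : 'M[R]_(n, m)) (W : 'M[R]_m) : 'End(sw_space B W) :=
  linfun (@sw_field R n m M D B W).

Definition eff_generator (R : realType) (n m : nat) (k : nat) (M D : 'M[R]_n)
    (B : 'M[R]_(n, m)) (W : 'M[R]_m) (kappa tau : R) :
    'End(eff_space k B W) :=
  linfun (@eff_field R n m k M D B W kappa tau).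

Definition dsum_field (R : realType) (U V : vectType R) (f : 'End(U))
    (g : 'End(V)) (z : U * V) : U * V := (f z.1, g z.2).

Definition lfun_dsum (R : realType) (U V : vectType R) (f : 'End(U))
    (g : 'End(V)) : 'End((U * V)%type) :=
  linfun (dsum_field f g).

(** ** Spectral notions for an endomorphism of a real vector space *)

Definition lfun_mx (R : realType) (U : vectType R) (f : 'End(U)) :
    'M[R]_(\dim {:U}) :=
  passmx.mxof (vbasis {:U}) (vbasis {:U}) f.

Definition lfun_char_poly (R : realType) (U : vectType R) (f : 'End(U)) :
    {poly R} :=
  char_poly (lfun_mx f).

Definition ceigenvalue (R : realType) (U : vectType R) (f : 'End(U))
    (l : R[i]) : bool :=
  eigenvalue (map_mx (real_complex R) (lfun_mx f)) l.

Definition alg_mult (R : realType) (U : vectType R) (f : 'End(U))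
    (l : R[i]) : nat :=
  mup l (map_poly (real_complex R) (lfun_char_poly f)).

Definition hurwitz (R : realType) (U : vectType R) (f : 'End(U)) : Prop :=
  forall l : R[i], ceigenvalue f l -> complex.Re l < 0.

(** ** The generators are linear and satisfy the differential equations *)

Lemma sw_field_linear (R : realType) (n m : nat) (M D : 'M[R]_n)
    (B : 'M[R]_(n, m)) (W : 'M[R]_m) : linear (@sw_field R n m M D B W).
Proof.
move=> c [x y] [x' y']; rewrite /sw_field /=; apply/pair_equal_spec; split.
  have -> : c *: (invmx M *m (- (D *m x) - B *m vsval y)) +
            invmx M *m (- (D *m x') - B *m vsval y') =
            invmx M *m (c *: (- (D *m x) - B *m vsval y) +
                        (- (D *m x') - B *m vsval y')).
    by rewrite scalemxAr -mulmxDr.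
  congr (_ *m _); rewrite linearP /= !mulmxDr -!scalemxAr.
  by rewrite scalerBr scalerN !opprD addrACA.
by rewrite mulmxDr -scalemxAr linearP.
Qed.

HB.instance Definition _ (R : realType) (n m : nat) (M D : 'M[R]_n)
    (B : 'M[R]_(n, m)) (W : 'M[R]_m) :=
  GRing.isSemilinear.Build R _ _ _ (@sw_field R n m M D B W)
    (GRing.semilinear_linear (@sw_field_linear R n m M D B W)).

Lemma eff_field_linear (R : realType) (n m k : nat) (M D : 'M[R]_n)
    (B : 'M[R]_(n, m)) (W : 'M[R]_m) (kappa tau : R) :
  linear (@eff_field R n m k M D B W kappa tau).
Proof.
move=> c [z h] [z' h']; apply/pair_equal_spec; split.
  exact: (@sw_field_linear R n m M D B W c z z').
change (tau^-1 *: (- kappa *: (c *: h + h')) =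
  c *: (tau^-1 *: (- kappa *: h)) + tau^-1 *: (- kappa *: h')).
by rewrite !scalerDr !scalerA -[c * _ * _]mulrA [c * _]mulrC.
Qed.

HB.instance Definition _ (R : realType) (n m k : nat) (M D : 'M[R]_n)
    (B : 'M[R]_(n, m)) (W : 'M[R]_m) (kappa tau : R) :=
  GRing.isSemilinear.Build R _ _ _ (@eff_field R n m k M D B W kappa tau)
    (GRing.semilinear_linear (@eff_field_linear R n m k M D B W kappa tau)).

Lemma dsum_field_linear (R : realType) (U V : vectType R) (f : 'End(U))
    (g : 'End(V)) : linear (dsum_field f g).
Proof. by move=> c [x y] [x' y']; rewrite /dsum_field /= !linearP. Qed.

HB.instance Definition _ (R : realType) (U V : vectType R) (f : 'End(U))
    (g : 'End(V)) :=
  GRing.isSemilinear.Build R _ _ _ (dsum_field f g)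
    (GRing.semilinear_linear (@dsum_field_linear R U V f g)).

Lemma lfun_dsumE (R : realType) (U V : vectType R) (f : 'End(U))
    (g : 'End(V)) (z : U * V) : lfun_dsum f g z = (f z.1, g z.2).
Proof. by rewrite /lfun_dsum lfunE. Qed.

Lemma sw_generatorE (R : realType) (n m : nat) (M D : 'M[R]_n)
    (B : 'M[R]_(n, m)) (W : 'M[R]_m) (z : sw_space B W) :
  M \in unitmx ->
  M *m (sw_generator M D B W z).1 = - (D *m z.1) - B *m vsval z.2 /\
  vsval (sw_generator M D B W z).2 = W *m B^T *m z.1.
Proof.
move=> Mu; rewrite /sw_generator lfunE /= mulKVmx//; split=> //.
rewrite vsprojK//.
have -> : W *m B^T *m z.1 = linfun (mulmx (W *m B^T)) z.1 by rewrite lfunE.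
exact/memv_img/memvf.
Qed.

Lemma eff_generatorE (R : realType) (n m k : nat) (M D : 'M[R]_n)
    (B : 'M[R]_(n, m)) (W : 'M[R]_m) (kappa tau : R)
    (z : eff_space k B W) :
  M \in unitmx -> tau != 0 ->
  let z' := eff_generator k M D B W kappa tau z in
  [/\ M *m z'.1.1 = - (D *m z.1.1) - B *m vsval z.1.2,
      vsval z'.1.2 = W *m B^T *m z.1.1
    & tau *: z'.2 = - kappa *: z.2].
Proof.
move=> Mu tau0 /=; have [e1 e2] := sw_generatorE D z.1 Mu.
rewrite /eff_generator lfunE /= scalerA divff// scale1r; split=> //.
  by rewrite mulKVmx.
by move: e2; rewrite /sw_generator lfunE.
Qed.

Lemma principal_bounds (R : realType) (x : R) : - pi <= principal x < pi.
Proof.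
have p0 : 0 < 2 * pi :> R by rewrite mulr_gt0// pi_gt0.
have /andP[] := floor_itv ((x + pi) / (2 * pi)).
rewrite /principal; set k := Num.floor _.
rewrite ler_pdivlMr// ltr_pdivrMr// intrD mulrDl mul1r [_ * k%:~R]mulrC.
by move=> l u; apply/andP; split; lra.
Qed.

(* Main.v *)
From HB Require Import structures.
Require Import Defs.
From mathcomp Require Import all_boot all_order all_algebra.
From mathcomp Require Import all_classical all_reals all_analysis.
From mathcomp Require Import complex.
From mathcomp Require Import ring lra.
Import Order.TTheory GRing.Theory Num.Theory.
Import numFieldNormedType.Exports.
Import passmx.
Local Open Scope ring_scope.

Set Implicit Arguments.
Unset Strict Implicit.
Unset Printing Implicit Defensive.

(** The weighted cycle projection [PH = H H^T W^-1] kills the weighted cut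
    space, because [PH W B^T = H (B H)^T = 0], and is idempotent, because the
    columns of [H] are [W^-1]-orthonormal.  Along a tangent solution
    [r' = W B^T nu - (kappa / tau) PH r] (lemma [derive1_tangent_output]):
    the swing dynamics enters only through the cut space, the control only
    through the cycle space.  Applying [PH], [1 - PH] and [H^T W^-1] to this
    one identity gives the three decoupled equations, and a mean value argument
    turns [(PH r)' = - (kappa / tau) PH r] into the exponential formula, also at
    time [0] where only continuity is known (lemma [exp_decay]).  Since
    [B PH = 0], the swing equation sees [r] only through its cut part.

    On the level of generators the decoupling is an equality of linear maps.
    The spectral claims follow from the multiplicativity of the characteristic
    polynomial over direct sums, which needs its independence of the chosen
    basis: the basis that [lfun_char_poly] picks on a product space is not
    the concatenation of the two bases that it picks on the factors.

    The swing generator is Hurwitz by a Lyapunov argument carried out on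
    eigenvectors.  A complex eigenvector is a pair of real vectors
    [(nu_i, W s_i)], [i = 1, 2], and the energy
    [E = sum_i (nu_i^T M nu_i + s_i^T W s_i)] is positive.  The coupling terms
    [nu^T B r] cancel between the two equations, so that
    [Re(lambda) E = - sum_i nu_i^T D nu_i] (lemma [swing_energy_rate]).  If
    [Re(lambda) >= 0], then both [nu_i] vanish, the first equation gives
    [B W s_i = 0], and [s_i = 0] since the cut space meets the kernel of [B]
    trivially (lemma [cut_kernel0]); the eigenvector would be zero. *)

(** * Characteristic polynomials of direct sums *)

(** The two sizes are distinct variables because the matrices compared below
    have provably, but not definitionally, equal sizes. *)
Lemma char_poly_similar (F : comNzRingType) (d d' : nat) (A : 'M[F]_d)
    (A' : 'M[F]_d') (P : 'M[F]_(d, d')) (Q : 'M[F]_(d', d)) :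
  P *m Q = 1%:M -> Q *m P = 1%:M -> A *m P = P *m A' ->
  char_poly A = char_poly A'.
Proof.
move=> PQ QP AP.
have dd : d = d'.
  by apply/eqP; rewrite eqn_leq (mulmx1_min PQ) (mulmx1_min QP).
subst d'; rewrite /char_poly.
have eqA : char_poly_mx A *m map_mx polyC P = map_mx polyC P *m char_poly_mx A'.
  by rewrite /char_poly_mx mulmxBl mulmxBr -!map_mxM AP scalar_mxC.
have dPQ : \det (map_mx polyC P) * \det (map_mx polyC Q) = 1.
  by rewrite -det_mulmx -map_mxM PQ map_mx1 det1.
have := congr1 determinant eqA; rewrite !det_mulmx => e.
rewrite -[LHS]mulr1 -dPQ mulrA e mulrC mulrA [_ * \det (map_mx _ P)]mulrC dPQ.
by rewrite mul1r.
Qed.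

(** The characteristic polynomial can be computed in any linear coordinate
    system, since the matrices in two systems are similar. *)
Lemma lfun_char_poly_coord (R : realType) (U : vectType R) (f : 'End(U))
    (d : nat) (A : 'M[R]_d) (phi : {linear U -> 'rV[R]_d})
    (psi : {linear 'rV[R]_d -> U}) :
  cancel phi psi -> cancel psi phi -> (forall x, phi (f x) = phi x *m A) ->
  lfun_char_poly f = char_poly A.
Proof.
move=> phiK psiK phif; rewrite /lfun_char_poly /lfun_mx.
set e := vbasis {:U}; have be : basis_of {:U} e by exact: vbasisP.
pose P : {linear 'rV[R]_(\dim {:U}) -> 'rV[R]_d} := phi \o vecof e.
pose Q : {linear 'rV[R]_d -> 'rV[R]_(\dim {:U})} := rVof e \o psi.
apply: (@char_poly_similar _ _ _ _ _ (lin1_mx P) (lin1_mx Q)).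
- apply/row_matrixP => i; rewrite row_mul !rowE mulmx1 !mul_rV_lin1 /=.
  by rewrite phiK vecofK.
- apply/row_matrixP => i; rewrite row_mul !rowE mulmx1 !mul_rV_lin1 /=.
  by rewrite rVofK // psiK.
- apply/row_matrixP => i; rewrite !row_mul !rowE !mul_rV_lin1 /=.
  by rewrite rVofK // phif.
Qed.

Section DirectSum.
Variables (R : realType) (U V : vectType R).

Definition dsum_rVof (z : U * V) : 'rV[R]_(\dim {:U} + \dim {:V}) :=
  row_mx (rVof (vbasis {:U}) z.1) (rVof (vbasis {:V}) z.2).

Definition dsum_vecof (v : 'rV[R]_(\dim {:U} + \dim {:V})) : U * V :=
  (vecof (vbasis {:U}) (lsubmx v), vecof (vbasis {:V}) (rsubmx v)).

Lemma dsum_rVof_linear : linear dsum_rVof.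
Proof.
by move=> c x y; rewrite /dsum_rVof scale_row_mx add_row_mx /= !linearP.
Qed.

Lemma dsum_vecof_linear : linear dsum_vecof.
Proof. by move=> c x y; rewrite /dsum_vecof !linearP. Qed.

HB.instance Definition _ := GRing.isSemilinear.Build R _ _ _ dsum_rVof
  (GRing.semilinear_linear dsum_rVof_linear).

HB.instance Definition _ := GRing.isSemilinear.Build R _ _ _ dsum_vecof
  (GRing.semilinear_linear dsum_vecof_linear).

Lemma lfun_char_poly_dsum (f : 'End(U)) (g : 'End(V)) :
  lfun_char_poly (lfun_dsum f g) = lfun_char_poly f * lfun_char_poly g.
Proof.
rewrite (@lfun_char_poly_coord _ _ _ _
  (block_mx (lfun_mx f) 0 0 (lfun_mx g)) dsum_rVof dsum_vecof).
- by rewrite /lfun_char_poly /char_poly char_block_diag_mx det_ublock.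
- move=> [x y]; rewrite /= /dsum_vecof /dsum_rVof row_mxKl row_mxKr /=.
  by rewrite !rVofK ?vbasisP.
- move=> v; rewrite /= /dsum_vecof /dsum_rVof /= !vecofK ?vbasisP //.
  exact: hsubmxK.
- move=> z; rewrite lfun_dsumE /= /dsum_rVof /= mul_row_block !mulmx0.
  by rewrite addr0 add0r !(@rVof_app _ _ _ _ _ (vbasisP _)).
Qed.

End DirectSum.

Lemma lfun_char_poly_scale (R : realType) (U : vectType R) (c : R) :
  lfun_char_poly (c *: \1%VF : 'End(U)) = ('X - c%:P) ^+ (\dim {:U}).
Proof.
rewrite /lfun_char_poly /lfun_mx linearZ /= mxof1; last first.
  exact/basis_free/vbasisP.
rewrite /char_poly /char_poly_mx scalemx1 map_scalar_mx /=.
by rewrite -raddfB det_scalar.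
Qed.

Lemma ceigenvalue_root (R : realType) (U : vectType R) (f : 'End(U))
    (l : R[i]) :
  ceigenvalue f l = root (map_poly (real_complex R) (lfun_char_poly f)) l.
Proof. by rewrite /ceigenvalue eigenvalue_root_char map_char_poly. Qed.

(** ** Appending a scalar block *)

Section Append.
Variables (R : realType) (U V : vectType R) (f : 'End(U)) (c : R).
Let g : 'End(V) := c *: \1%VF.

Lemma lfun_char_poly_append :
  lfun_char_poly (lfun_dsum f g)
    = lfun_char_poly f * ('X - c%:P) ^+ (\dim {:V}).
Proof. by rewrite lfun_char_poly_dsum lfun_char_poly_scale. Qed.

Lemma map_char_poly_append :
  map_poly (real_complex R) (lfun_char_poly (lfun_dsum f g))
    = map_poly (real_complex R) (lfun_char_poly f)
      * ('X - (c%:C%C)%:P) ^+ (\dim {:V}).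
Proof.
rewrite lfun_char_poly_append rmorphM rmorphXn rmorphB /=.
by rewrite map_polyX map_polyC.
Qed.

Lemma alg_mult_append (l : R[i]) :
  alg_mult (lfun_dsum f g) l
    = (alg_mult f l + (l == c%:C%C) * \dim {:V})%N.
Proof.
rewrite /alg_mult map_char_poly_append mupM.
- by rewrite mup_XsubCX eq_sym; case: (l == _); rewrite ?mul1n ?mul0n.
- by rewrite map_poly_eq0 monic_neq0 ?char_poly_monic.
- by rewrite expf_neq0 // polyXsubC_eq0.
Qed.

Lemma ceigenvalue_append (l : R[i]) :
  ceigenvalue (lfun_dsum f g) l
    = ceigenvalue f l || ((0 < \dim {:V})%N && (l == c%:C%C)).
Proof.
rewrite !ceigenvalue_root map_char_poly_append rootM; congr (_ || _).
case: (\dim _) => [|d]; first by rewrite expr0 (negPf (root1 _)).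
by rewrite root_exp_XsubC.
Qed.

Lemma hurwitz_append : c < 0 -> hurwitz (lfun_dsum f g) <-> hurwitz f.
Proof.
move=> c0; split=> hf l el; first by apply: hf; rewrite ceigenvalue_append el.
by move: el; rewrite ceigenvalue_append => /orP[/hf //|/andP[_ /eqP ->]].
Qed.

End Append.

(** The real and imaginary parts of a complex eigenvector span a real invariant
    subspace on which [f] acts by the matrix of multiplication by [l]; this
    keeps the stability argument in the real space [U], without
    complexifying it. *)
Lemma ceigenvalue_real_pair (R : realType) (U : vectType R) (f : 'End(U))
    (l : R[i]) :
  ceigenvalue f l ->
  exists x y : U, [/\ (x, y) != 0,
    f x = complex.Re l *: x - complex.Im l *: y
  & f y = complex.Im l *: x + complex.Re l *: y].
Proof.
rewrite /ceigenvalue => /eigenvalueP[v].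
set A := lfun_mx f; set e := vbasis {:U} => vA v0.
have be : basis_of {:U} e by exact: vbasisP.
pose a := map_mx (@complex.Re R) v; pose b := map_mx (@complex.Im R) v.
have ReMr : forall (z : R[i]) (r : R),
    complex.Re (z * r%:C%C) = complex.Re z * r.
  by case=> zr zi r; rewrite /= mulr0 subr0.
have ImMr : forall (z : R[i]) (r : R),
    complex.Im (z * r%:C%C) = complex.Im z * r.
  by case=> zr zi r; rewrite /= mulr0 add0r.
have aA : a *m A = complex.Re l *: a - complex.Im l *: b.
  apply/rowP => j; have /rowP/(_ j)/(congr1 (@complex.Re R)) := vA.
  rewrite !mxE raddf_sum => e1; rewrite [LHS](_ : _ = complex.Re (l * v 0 j)).
    by case: (l) => ??; case: (v 0 j).
  by rewrite -e1; apply: eq_bigr => i _; rewrite !mxE; exact/esym/ReMr.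
have bA : b *m A = complex.Im l *: a + complex.Re l *: b.
  apply/rowP => j; have /rowP/(_ j)/(congr1 (@complex.Im R)) := vA.
  rewrite !mxE raddf_sum => e1; rewrite [LHS](_ : _ = complex.Im (l * v 0 j)).
    by case: (l) => ??; case: (v 0 j) => ??; rewrite /= addrC.
  by rewrite -e1; apply: eq_bigr => i _; rewrite !mxE; exact/esym/ImMr.
exists (vecof e a), (vecof e b); split.
- apply: contra v0 => /eqP[/eqP]; rewrite vecof_eq0 // => /eqP a0.
  move/eqP; rewrite vecof_eq0 // => /eqP b0.
  apply/eqP/rowP => j; have /rowP/(_ j) := a0.
  have /rowP/(_ j) := b0; rewrite !mxE.
  by case: (v 0 j) => ?? /= -> ->.
- by rewrite (@hom_vecof _ _ _ _ _ be) -/(lfun_mx f) -/A aA !linearB !linearZ.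
- by rewrite (@hom_vecof _ _ _ _ _ be) -/(lfun_mx f) -/A bA !linearD !linearZ.
Qed.

(** * Positive diagonal forms *)

Section Dot.
Variable R : realType.

Definition dotc (n : nat) (x y : 'cV[R]_n) : R := (x^T *m y) 0 0.

Lemma dotcC n (x y : 'cV[R]_n) : dotc x y = dotc y x.
Proof. by rewrite /dotc -[y^T *m x]trmxK trmx_mul trmxK [in RHS]mxE. Qed.

Lemma dotcDr n (x y z : 'cV[R]_n) : dotc x (y + z) = dotc x y + dotc x z.
Proof. by rewrite /dotc mulmxDr mxE. Qed.

Lemma dotcNr n (x y : 'cV[R]_n) : dotc x (- y) = - dotc x y.
Proof. by rewrite /dotc mulmxN mxE. Qed.

Lemma dotcZr n (c : R) (x y : 'cV[R]_n) : dotc x (c *: y) = c * dotc x y.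
Proof. by rewrite /dotc -scalemxAr mxE. Qed.

Lemma dotcBr n (x y z : 'cV[R]_n) : dotc x (y - z) = dotc x y - dotc x z.
Proof. by rewrite dotcDr dotcNr. Qed.

Lemma dotc0r n (x : 'cV[R]_n) : dotc x 0 = 0.
Proof. by rewrite /dotc mulmx0 mxE. Qed.

Lemma dotc_mulmx n m (A : 'M[R]_(n, m)) (x : 'cV[R]_n) (y : 'cV[R]_m) :
  dotc x (A *m y) = dotc (A^T *m x) y.
Proof. by rewrite /dotc trmx_mul trmxK mulmxA. Qed.

Lemma pos_diag_tr n (A : 'M[R]_n) : pos_diag_mx A -> A^T = A.
Proof. by move=> [/diag_mxP[d ->] _]; rewrite tr_diag_mx. Qed.

Lemma pos_diag_unit n (A : 'M[R]_n) : pos_diag_mx A -> A \in unitmx.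
Proof.
move=> [/diag_mxP[d ->] d0]; rewrite unitmxE det_diag unitfE.
apply/prodf_neq0 => i _; have := d0 i.
by rewrite mxE eqxx mulr1n => /lt0r_neq0.
Qed.

Lemma pos_diag_dotcE n (A : 'M[R]_n) (x : 'cV[R]_n) :
  pos_diag_mx A -> dotc x (A *m x) = \sum_i A i i * x i 0 ^+ 2.
Proof.
move=> [/diag_mxP[d ->] _]; rewrite /dotc mxE; apply: eq_bigr => i _.
by rewrite mul_diag_mx !mxE eqxx mulr1n mulrCA -expr2.
Qed.

Lemma pos_diag_ge0 n (A : 'M[R]_n) (x : 'cV[R]_n) :
  pos_diag_mx A -> 0 <= dotc x (A *m x).
Proof.
move=> Ap; rewrite pos_diag_dotcE //; apply: sumr_ge0 => i _.
by rewrite mulr_ge0 ?sqr_ge0 // ltW //; case: Ap.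
Qed.

Lemma pos_diag_eq0 n (A : 'M[R]_n) (x : 'cV[R]_n) :
  pos_diag_mx A -> dotc x (A *m x) <= 0 -> x = 0.
Proof.
move=> Ap x0.
have : dotc x (A *m x) == 0 by rewrite eq_le x0 pos_diag_ge0.
rewrite pos_diag_dotcE // psumr_eq0; last first.
  by move=> i _; rewrite mulr_ge0 ?sqr_ge0 // ltW //; case: Ap.
move=> /allP h; apply/colP => i; have := h i (mem_index_enum i).
rewrite mulf_eq0 sqrf_eq0 /= => /orP[/eqP Ai|/eqP ->]; last by rewrite mxE.
by have [_ /(_ i)] := Ap; rewrite Ai ltxx.
Qed.

End Dot.

Lemma cos_principal_gt0 (R : realType) (x gamma : R) :
  gamma < pi / 2 -> `|principal x| <= gamma -> 0 < cos (principal x).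
Proof.
move=> gp xg; apply: cos_gt0_pihalf.
by have := le_lt_trans xg gp; rewrite ltr_norml => /andP[-> ->].
Qed.

(** Cohesiveness is what makes every cosine in the weights positive. *)
Lemma flow_weight_pos (R : realType) (n m : nat) (a : 'rV[R]_m)
    (B : 'M[R]_(n, m)) (theta : 'cV[R]_n) (u : 'cV[R]_m) :
  (forall e, 0 < a 0 e) -> angle_cohesive B theta u ->
  pos_diag_mx (flow_weight a B theta u).
Proof.
move=> a0 [g [/andP[_ gp] ge]]; split; first exact: diag_mx_is_diag.
move=> e; rewrite mxE eqxx mulr1n mxE mulr_gt0 //.
exact: (cos_principal_gt0 gp (ge e)).
Qed.

(** * The weighted cycle and cut projections *)

Section CycleCut.
Variables (R : realType) (n m k : nat) (B : 'M[R]_(n, m)) (W : 'M[R]_m).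
Variable H : 'M[R]_(m, k).
Hypothesis Wu : W \in unitmx.

Lemma mem_cut_spaceP (r : 'cV[R]_m) :
  reflect (exists x, r = W *m B^T *m x) (r \in cut_space B W).
Proof.
apply: (iffP memv_imgP) => [[x _ ->]|[x ->]]; exists x; rewrite ?lfunE //.
by rewrite memvf.
Qed.

Hypothesis BH : cycle_basis B H.

Lemma cycle_basis_mul0 : B *m H = 0.
Proof.
have [_ /andP[/sub_kermxP e _]] := BH.
by apply: trmx_inj; rewrite trmx_mul trmx0.
Qed.

(** Fredholm alternative for [B^T]: the solvability of [B^T v = x] is tested by
    the cokernel of [B], which consists of cycles. *)
Lemma cycle_basis_orth (x : 'cV[R]_m) :
  H^T *m x = 0 -> exists v, x = B^T *m v.
Proof.
move=> Hx; have [_ /andP[_ kH]] := BH.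
have : ((cokermx B)^T <= H^T)%MS.
  apply: submx_trans kH; apply/sub_kermxP.
  by rewrite -trmx_mul mulmx_coker trmx0.
case/submxP => X eX.
have : (x^T <= B)%MS.
  rewrite submxE -[cokermx B]trmxK eX trmx_mul trmxK mulmxA.
  by rewrite -[H]trmxK -trmx_mul Hx trmx0 mul0mx.
by case/submxP => Y eY; exists Y^T; rewrite -trmx_mul -eY trmxK.
Qed.

Lemma cycle_proj_cut : cycle_proj W H *m (W *m B^T) = 0.
Proof.
rewrite /cycle_proj mulmxA mulmxKV // -mulmxA -trmx_mul.
by rewrite cycle_basis_mul0 trmx0 mulmx0.
Qed.

Lemma cut_proj_cut : cut_proj W H *m (W *m B^T) = W *m B^T.
Proof. by rewrite /cut_proj mulmxBl mul1mx cycle_proj_cut subr0. Qed.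

Lemma cycle_coord_cut : H^T *m invmx W *m (W *m B^T) = 0.
Proof.
by rewrite mulmxA mulmxKV // -trmx_mul cycle_basis_mul0 trmx0.
Qed.

Lemma mul_cut_proj : B *m cut_proj W H = B.
Proof.
rewrite /cut_proj /cycle_proj mulmxBr mulmx1 !mulmxA cycle_basis_mul0.
by rewrite !mul0mx subr0.
Qed.

Hypothesis HH : H^T *m invmx W *m H = 1%:M.

Lemma cycle_proj_idem : cycle_proj W H *m cycle_proj W H = cycle_proj W H.
Proof.
rewrite /cycle_proj -!mulmxA; congr (_ *m _).
by rewrite 2!mulmxA HH mul1mx.
Qed.

Lemma cycle_coord_proj :
  H^T *m invmx W *m cycle_proj W H = H^T *m invmx W.
Proof. by rewrite /cycle_proj !mulmxA HH mul1mx. Qed.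

(** [W^-1 (1 - PH) r] is orthogonal to all cycles, hence of the form
    [B^T v]. *)
Lemma cut_proj_mem (r : 'cV[R]_m) : cut_proj W H *m r \in cut_space B W.
Proof.
apply/mem_cut_spaceP.
have [|v e] := @cycle_basis_orth (invmx W *m (cut_proj W H *m r)).
  rewrite !mulmxA /cut_proj mulmxBr mulmx1 cycle_coord_proj subrr.
  by rewrite mul0mx.
by exists v; rewrite -mulmxA -e mulKVmx.
Qed.

End CycleCut.

(** * Stability of the swing generator *)

Section Swing.
Variables (R : realType) (n m : nat) (M D : 'M[R]_n) (B : 'M[R]_(n, m)).
Variable W : 'M[R]_m.
Hypotheses (Mp : pos_diag_mx M) (Dp : pos_diag_mx D) (Wp : pos_diag_mx W).

(** The hypotheses say that [(n1, W s1)] and [(n2, W s2)] are the real and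
    imaginary parts of an eigenvector with eigenvalue [al + i be].  Pairing the
    equations with [n1], [n2], [W s1], [W s2] and adding, the terms in [be]
    cancel because [M] and [W] are symmetric, and the coupling terms cancel
    because [B] and [B^T] enter with opposite signs. *)
Lemma swing_energy_rate (al be : R) (n1 n2 : 'cV[R]_n) (s1 s2 : 'cV[R]_m) :
  M *m (al *: n1 - be *: n2) = - (D *m n1) - B *m (W *m s1) ->
  M *m (be *: n1 + al *: n2) = - (D *m n2) - B *m (W *m s2) ->
  al *: s1 - be *: s2 = B^T *m n1 ->
  be *: s1 + al *: s2 = B^T *m n2 ->
  al * (dotc n1 (M *m n1) + dotc n2 (M *m n2)
        + dotc s1 (W *m s1) + dotc s2 (W *m s2))
  = - (dotc n1 (D *m n1) + dotc n2 (D *m n2)).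
Proof.
move=> /(congr1 (dotc n1)) e1 /(congr1 (dotc n2)) e2.
move=> /(congr1 (dotc (W *m s1))) e3 /(congr1 (dotc (W *m s2))) e4.
move: e1 e2; rewrite mulmxBr mulmxDr -!scalemxAr.
rewrite !(dotcBr, dotcDr, dotcNr, dotcZr).
have symM : dotc n2 (M *m n1) = dotc n1 (M *m n2).
  by rewrite dotc_mulmx pos_diag_tr // dotcC.
have symW : dotc (W *m s2) s1 = dotc (W *m s1) s2.
  by rewrite dotcC dotc_mulmx pos_diag_tr.
move: e3 e4; rewrite !(dotcBr, dotcDr, dotcNr, dotcZr) symM symW.
rewrite !(dotc_mulmx B^T) !trmxK ![dotc (B *m _) _]dotcC.
rewrite ![dotc (W *m _) _]dotcC => e3 e4 e1 e2.
rewrite !mulrDr; lra.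
Qed.

(** A cut flow [W B^T v] without divergence vanishes: its energy is
    [v^T (B W s) = 0]. *)
Lemma cut_kernel0 (s : 'cV[R]_m) (v : 'cV[R]_n) :
  s = B^T *m v -> B *m (W *m s) = 0 -> s = 0.
Proof.
move=> es Bs; apply: (pos_diag_eq0 Wp).
by rewrite {1}es -dotc_mulmx Bs dotc0r.
Qed.

Lemma hurwitz_sw : hurwitz (sw_generator M D B W).
Proof.
move=> l /ceigenvalue_real_pair[[n1 r1] [[n2 r2] [nz e1 e2]]].
set al := complex.Re l in e1 e2 *; set be := complex.Im l in e1 e2.
have Mu := pos_diag_unit Mp; have Wu := pos_diag_unit Wp.
have [a1 b1] := sw_generatorE D ((n1, r1) : sw_space B W) Mu.
have [a2 b2] := sw_generatorE D ((n2, r2) : sw_space B W) Mu.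
rewrite e1 /= in a1 b1; rewrite e2 /= in a2 b2.
have [v1 ev1] : exists v, vsval r1 = W *m B^T *m v.
  exact/mem_cut_spaceP/subvsP.
have [v2 ev2] : exists v, vsval r2 = W *m B^T *m v.
  exact/mem_cut_spaceP/subvsP.
set s1 := B^T *m v1; set s2 := B^T *m v2.
rewrite -mulmxA -/s1 in ev1; rewrite -mulmxA -/s2 in ev2.
have c1 : al *: s1 - be *: s2 = B^T *m n1.
  move: b1; rewrite ev1 ev2 !scalemxAr -mulmxBr -mulmxA.
  by move/(congr1 (mulmx (invmx W))); rewrite !mulKmx.
have c2 : be *: s1 + al *: s2 = B^T *m n2.
  move: b2; rewrite ev1 ev2 !scalemxAr -mulmxDr -mulmxA.
  by move/(congr1 (mulmx (invmx W))); rewrite !mulKmx.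
rewrite ev1 in a1; rewrite ev2 in a2.
have en := swing_energy_rate a1 a2 c1 c2.
rewrite ltNge; apply: contra nz => al0.
have p1 := pos_diag_ge0 n1 Mp; have p2 := pos_diag_ge0 n2 Mp.
have p3 := pos_diag_ge0 s1 Wp; have p4 := pos_diag_ge0 s2 Wp.
have q1 := pos_diag_ge0 n1 Dp; have q2 := pos_diag_ge0 n2 Dp.
have en0 : 0 <= al * (dotc n1 (M *m n1) + dotc n2 (M *m n2)
        + dotc s1 (W *m s1) + dotc s2 (W *m s2)).
  by rewrite mulr_ge0 // !addr_ge0.
(* From here on [al >= 0], so the dissipation identity [en] forces
   [n1 = n2 = 0]. *)
have n10 : n1 = 0 by apply: (pos_diag_eq0 Dp); lra.
have n20 : n2 = 0 by apply: (pos_diag_eq0 Dp); lra.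
have s10 : s1 = 0.
  apply: (@cut_kernel0 s1 v1) => //; move: a1.
  rewrite n10 n20 !scaler0 subr0 !mulmx0 oppr0 add0r => /esym/eqP.
  by rewrite oppr_eq0 => /eqP.
have s20 : s2 = 0.
  apply: (@cut_kernel0 s2 v2) => //; move: a2.
  rewrite n10 n20 !scaler0 addr0 !mulmx0 oppr0 add0r => /esym/eqP.
  by rewrite oppr_eq0 => /eqP.
have r10 : r1 = 0 by apply: val_inj; rewrite /= ev1 s10 mulmx0.
have r20 : r2 = 0 by apply: val_inj; rewrite /= ev2 s20 mulmx0.
by rewrite n10 n20 r10 r20.
Qed.

End Swing.

Lemma eff_generator_dsum (R : realType) (n m k : nat) (M D : 'M[R]_n)
    (B : 'M[R]_(n, m)) (W : 'M[R]_m) (kappa tau : R) :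
  eff_generator k M D B W kappa tau
    = lfun_dsum (sw_generator M D B W) (- (kappa / tau) *: \1%VF).
Proof.
apply/lfunP => z; rewrite lfun_dsumE scale_lfunE id_lfunE.
rewrite /eff_generator /sw_generator !lfunE /= /eff_field.
by rewrite scalerA mulrC mulNr.
Qed.

(** * Differentiating vector-valued curves *)

Section MatrixCalculus.
Variable R : realType.

Lemma mulmx_continuous (p m : nat) (A : 'M[R]_(p, m)) :
  continuous (mulmx A : 'cV[R]_m -> 'cV[R]_p).
Proof.
have -> : mulmx A = fun x : 'cV[R]_m => \sum_j x j 0 *: col j A.
  apply/funext => x; apply/colP => i; rewrite summxE mxE.
  by apply: eq_bigr => j _; rewrite !mxE mulrC.
apply: (@continuous_big 'cV[R]_p 'I_m +%R) => [|j _].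
  exact: add_continuous.
move=> x; apply: (@continuous_comp _ _ _ (fun y : 'cV[R]_m => y j 0)
  (fun c : R => c *: col j A)); first exact: coord_continuous.
exact: scalel_continuous.
Qed.

Lemma is_derive_mulmx (p m : nat) (A : 'M[R]_(p, m)) (f : R -> 'cV[R]_m)
    (t : R) :
  derivable f t 1 ->
  is_derive t 1 (fun s => A *m f s) (A *m derive1 f t).
Proof.
move=> df.
have dA x : differentiable (mulmx A : 'cV[R]_m -> 'cV[R]_p) x.
  by apply: linear_differentiable; exact: mulmx_continuous.
have dft : differentiable f t by apply/derivable1_diffP.
have dc : differentiable (mulmx A \o f) t by exact: differentiable_comp.
apply: DeriveDef; first exact/diff_derivable.
rewrite -/(mulmx A \o f) deriveE // diff_comp // diff_lin /=; last first.
  exact: mulmx_continuous.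
by rewrite derive1E deriveE.
Qed.

Lemma oy_Rcontinuous_mulmx (p m : nat) (A : 'M[R]_(p, m)) (f : R -> 'cV[R]_m) :
  derivable_oy_Rcontinuous f 0 ->
  derivable_oy_Rcontinuous (fun s => A *m f s) 0.
Proof.
move=> [df cf]; split.
  by move=> t t0; have [] := is_derive_mulmx A (df t t0).
by apply: cvg_comp cf _; exact: mulmx_continuous.
Qed.

Lemma oy_Rcontinuous_add (m : nat) (f g : R -> 'cV[R]_m) :
  derivable_oy_Rcontinuous f 0 -> derivable_oy_Rcontinuous g 0 ->
  derivable_oy_Rcontinuous (fun s => f s + g s) 0.
Proof.
move=> [df cf] [dg cg]; split; last exact: cvgD.
by move=> t t0; apply: derivableD; [exact: df|exact: dg].
Qed.

(** Each entry of [expR (c * t) *: g t] has zero derivative on the open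
    half-line and is continuous up to [0], hence is constant by the mean value
    theorem. *)
Lemma exp_decay (m : nat) (c : R) (g : R -> 'cV[R]_m) :
  derivable_oy_Rcontinuous g 0 ->
  (forall t : R, 0 < t -> derive1 g t = - c *: g t) ->
  forall t : R, 0 <= t -> g t = expR (- c * t) *: g 0.
Proof.
move=> [dg cg] eg t t0; apply/matrixP => i j; rewrite mxE.
pose k s := expR (c * s) * g s i j.
have dgij (s : R) : 0 < s -> is_derive s 1 (fun s => g s i j) (- c * g s i j).
  move=> s0; have dgs : derivable g s 1 by apply: dg; rewrite in_itv /= s0.
  apply: DeriveDef; first exact: ((derivable_mxP g s 1).1 dgs i j).
  have := eg _ s0; rewrite derive1E derive_mx // => /matrixP/(_ i j).
  by rewrite !mxE.
have dexp (s : R) : is_derive s 1 (fun s => expR (c * s)) (expR (c * s) * c).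
  have dc : is_derive s 1 ( *%R c) c.
    by rewrite -[X in is_derive _ _ _ X]mulr1; exact: is_deriveZ.
  exact: (@is_derive1_comp _ expR ( *%R c)).
have dk (s : R) : 0 < s -> is_derive s 1 k 0.
  move=> s0; have d1 := dgij s s0; have d2 := dexp s.
  have d12 := is_deriveM d2 d1.
  apply: (is_derive_eq d12).
  by rewrite /= /GRing.scale /=; ring.
have ok : derivable_oy_Rcontinuous k 0.
  split=> [s|]; first by rewrite in_itv /= andbT => /dk[].
  apply: cvgM; last first.
    apply: (@cvg_comp _ _ _ g (fun y : 'cV[R]_m => y i j)); first exact: cg.
    exact: coord_continuous.
  apply: cvg_at_right_filter.
  have /derivable1_diffP/differentiable_continuous : derivable
    (fun s : R => expR (c * s)) 0 1 by case: (dexp 0).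
  exact.
have ck : ({within `[0, t], continuous k})%classic.
  apply: continuous_subspaceW (derivable_oy_Rcontinuous_within_itvcy ok).
  by apply: subset_itvl; rewrite bnd_simp.
have dk0 (s : R) : s \in `]0, t[ -> is_derive s 1 k 0.
  by rewrite in_itv /= => /andP[/dk].
have [x _] := MVT_segment t0 dk0 ck.
rewrite mul0r => /eqP; rewrite subr_eq0 /k mulr0 expR0 mul1r => /eqP <-.
by rewrite mulrA -expRD mulNr addNr expR0 mul1r.
Qed.

End MatrixCalculus.

(** * The output of the tangent system *)

Section TangentOutput.
Variables (R : realType) (n m k : nat) (M D : 'M[R]_n) (B : 'M[R]_(n, m)).
Variables (W : 'M[R]_m) (H : 'M[R]_(m, k)) (kappa tau : R).
Variables (vth nu : R -> 'cV[R]_n) (w : R -> 'cV[R]_m).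
Hypothesis Wu : W \in unitmx.
Hypothesis BH : cycle_basis B H.
Hypothesis HH : H^T *m invmx W *m H = 1%:M.
Hypothesis tau0 : 0 < tau.
Hypothesis sol : tangent_solution M D B W H kappa tau vth nu w.

Let r := tangent_output B W vth w.

Lemma tangent_output_oy_Rcontinuous : derivable_oy_Rcontinuous r 0.
Proof.
case: sol => cv _ cw _; apply: oy_Rcontinuous_add; exact: oy_Rcontinuous_mulmx.
Qed.

Lemma derivable_tangent_output (t : R) : 0 < t -> derivable r t 1.
Proof.
by move=> t0; apply: tangent_output_oy_Rcontinuous.1; rewrite in_itv /= t0.
Qed.

(** The factor [W^-1] in the control law cancels the factor [W] in front of
    [w] in the output, so the control acts on [r] by [- (kappa / tau) PH]. *)
Lemma derive1_tangent_output (t : R) : 0 < t ->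
  derive1 r t
    = W *m B^T *m nu t - (kappa / tau) *: (cycle_proj W H *m r t).
Proof.
move=> t0; case: sol => -[dv _] _ [dw _] /(_ t t0)[ev _ ew].
have it0 : t \in `]0, +oo[ by rewrite in_itv /= t0.
have d1 := is_derive_mulmx (W *m B^T) (dv t it0).
have d2 := is_derive_mulmx W (dw t it0).
have d12 := is_deriveD d1 d2.
have -> : derive1 r t = W *m B^T *m derive1 vth t + W *m derive1 w t.
  by rewrite derive1E; exact: (derive_val (is_derive := d12)).
rewrite ev; congr (_ + _).
have -> : derive1 w t
    = tau^-1 *: (- kappa *: (invmx W *m (cycle_proj W H *m r t))).
  by rewrite -ew scalerA mulVf ?scale1r // gt_eqF.
by rewrite -!scalemxAr mulKVmx // scalerA mulrN mulrC scaleNr.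
Qed.

Lemma derive1_mul_output (p : nat) (A : 'M[R]_(p, m)) (t : R) : 0 < t ->
  derive1 (fun s => A *m r s) t = A *m derive1 r t.
Proof.
move=> t0; have d := is_derive_mulmx A (derivable_tangent_output t0).
by rewrite [LHS]derive1E; exact: (derive_val (is_derive := d)).
Qed.

Lemma derive1_cycle_part (t : R) : 0 < t ->
  derive1 (fun s => cycle_proj W H *m r s) t
    = - (kappa / tau) *: (cycle_proj W H *m r t).
Proof.
move=> t0; rewrite derive1_mul_output // derive1_tangent_output //.
rewrite mulmxBr mulmxA cycle_proj_cut // mul0mx sub0r -scalemxAr mulmxA.
by rewrite cycle_proj_idem // scaleNr.
Qed.

Lemma derive1_cut_part (t : R) : 0 < t ->
  derive1 (fun s => cut_proj W H *m r s) t = W *m B^T *m nu t.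
Proof.
move=> t0; rewrite derive1_mul_output // derive1_tangent_output //.
rewrite mulmxBr mulmxA cut_proj_cut // -scalemxAr mulmxA /cut_proj mulmxBl.
by rewrite mul1mx cycle_proj_idem // subrr mul0mx scaler0 subr0.
Qed.

Lemma derive1_cycle_coord (t : R) : 0 < t ->
  derive1 (fun s => H^T *m invmx W *m r s) t
    = - (kappa / tau) *: (H^T *m invmx W *m r t).
Proof.
move=> t0; rewrite derive1_mul_output // derive1_tangent_output //.
rewrite mulmxBr mulmxA cycle_coord_cut // mul0mx sub0r -scalemxAr mulmxA.
by rewrite cycle_coord_proj // scaleNr.
Qed.

Lemma tangent_block_solution :
  block_solution M D B W kappa tau nu (fun t => cut_proj W H *m r t)
    (fun t => H^T *m invmx W *m r t).
Proof.
have rd := tangent_output_oy_Rcontinuous.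
case: (sol) => _ cnu _ eqs; split=> //.
- exact: oy_Rcontinuous_mulmx.
- exact: oy_Rcontinuous_mulmx.
- by move=> t _; exact: cut_proj_mem.
move=> t t0; have [_ enu _] := eqs t t0; split.
- by rewrite mulmxA mul_cut_proj.
- exact: derive1_cut_part.
- rewrite derive1_cycle_coord // scalerA mulrN mulrCA divff ?mulr1 //.
  by rewrite gt_eqF.
Qed.

End TangentOutput.

(** * The theorem *)

Theorem theorem12p4 (R : realType) (n m : nat) (tail head : 'I_m -> 'I_n)
    (M D : 'M[R]_n) (a : 'rV[R]_m) (p theta_s : 'cV[R]_n) (u_s : 'cV[R]_m)
    (H : 'M[R]_(m, betti1 n m)) (kappa tau : R) :
  loopless tail head ->
  graph_connected tail head ->
  pos_diag_mx M -> pos_diag_mx D ->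
  (forall e, 0 < a 0 e) ->
  let b1 := betti1 n m in
  let B := incidence_mx R tail head in
  let f_s := line_flow a B theta_s u_s in
  let W := flow_weight a B theta_s u_s in
  let PH := cycle_proj W H in
  let PC := cut_proj W H in
  let A_sw := sw_generator M D B W in
  let A_id := eff_generator b1 M D B W kappa tau in
  angle_cohesive B theta_s u_s ->
  cycle_basis B H ->
  H^T *m invmx W *m H = 1%:M ->
  p = B *m f_s ->
  PH *m f_s = 0 ->
  0 < kappa -> 0 < tau ->
  (forall (vth nu : R -> 'cV[R]_n) (w : R -> 'cV[R]_m),
    tangent_solution M D B W H kappa tau vth nu w ->
    let r := tangent_output B W vth w in
    [/\ forall t, 0 < t ->
          derivable (fun s => PH *m r s) t 1 /\
          tau *: derive1 (fun s => PH *m r s) t = - kappa *: (PH *m r t),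
        forall t, 0 <= t ->
          PH *m r t = expR (- (kappa / tau) * t) *: (PH *m r 0)
      & block_solution M D B W kappa tau
          nu (fun t => PC *m r t) (fun t => H^T *m invmx W *m r t)]) /\
  [/\ A_id = lfun_dsum A_sw (- (kappa / tau) *: \1%VF),
      lfun_char_poly A_id
        = lfun_char_poly A_sw * ('X + (kappa / tau)%:P) ^+ b1,
      (forall l : R[i],
        alg_mult A_id l
          = (alg_mult A_sw l + (l == (- (kappa / tau))%:C%C) * b1)%N) /\
      (forall l : R[i],
        ceigenvalue A_id l =
          ceigenvalue A_sw l
          || ((0 < b1)%N && (l == (- (kappa / tau))%:C%C))),
      (hurwitz A_id <-> hurwitz A_sw)
    & hurwitz A_sw /\ hurwitz A_id].
Proof.
move=> _ _ Mp Dp a0 b1 B f_s W PH PC A_sw A_id coh BH HH _ _ kappa0 tau0.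
have Wp : pos_diag_mx W by exact: flow_weight_pos.
have Wu := pos_diag_unit Wp.
have c0 : - (kappa / tau) < 0 by rewrite oppr_lt0 divr_gt0.
have dimb : \dim {: 'cV[R]_b1} = b1 by rewrite dimvf /dim /= muln1.
split=> [vth nu w sol r|].
  have rd := tangent_output_oy_Rcontinuous sol; split.
  - move=> t t0; split.
      by have [] := is_derive_mulmx PH (derivable_tangent_output sol t0).
    rewrite (derive1_cycle_part Wu BH HH tau0 sol t0) scalerA mulrN mulrCA.
    by rewrite divff ?mulr1 // gt_eqF.
  - apply: exp_decay; first exact: oy_Rcontinuous_mulmx.
    by move=> t t0; exact: (derive1_cycle_part Wu BH HH tau0 sol t0).
  - exact: (tangent_block_solution Wu BH HH tau0 sol).
have swH : hurwitz A_sw by exact: hurwitz_sw.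
have eA : A_id = lfun_dsum A_sw (- (kappa / tau) *: \1%VF).
  exact: eff_generator_dsum.
split=> //; rewrite ?eA.
- by rewrite lfun_char_poly_append dimb rmorphN opprK.
- split=> l; first by rewrite alg_mult_append dimb.
  by rewrite ceigenvalue_append dimb.
- exact: hurwitz_append.
- by split=> //; exact/hurwitz_append.
Qed.
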